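(* Algorithm 3 is a factor-$2$ approximation algorithm for $1|(a_j,p_j,p_j)|\sum C_j$. That is, Algorithm 3 runs in polynomial time, and for every instance with $L_j=b_j=p_j$ for all jobs $j$ and arbitrary $a_j$, it outputs a feasible schedule whose sum of completion times is at most $2$ times the minimum sum of completion times over all feasible schedules.
   Context: Coupled task scheduling on a single machine: each job $j\in\{1,\dots,n\}$ has a first task of processing time $a_j>0$, a second task of processing time $b_j>0$, and a delay time $L_j\ge 0$. A feasible schedule assigns a starting time $S_j\ge 0$ to each job $j$; the first task occupies $[S_j,S_j+a_j]$, the second task occupies $[S_j+a_j+L_j,\,S_j+a_j+L_j+b_j]$ (the delay is exact, no preemption), and no two of the $2n$ tasks overlap (their intervals have disjoint interiors). Other tasks may be processed during the delay of a job. The completion time of $j$ is $C_j=S_j+a_j+L_j+b_j$, and the objective is to minimize $\sum_{j=1}^n C_j$. Algorithm 3. Input: an instance with $L_j=b_j=p_j$ for all $j$. Step 1: sort the jobs in non-decreasing order of $a_j+p_j$. Step 2: in this order, schedule the first task of each job right after the second task of the previously scheduled job has completed (the first job starting at time $0$), and its second task according to the delay time. *)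

(* Defs.v *)
From HB Require Import structures.
From mathcomp Require Import all_boot all_order all_algebra all_fingroup.

Set Implicit Arguments.
Unset Strict Implicit.
Unset Printing Implicit Defensive.

Import Order.TTheory GRing.Theory Num.Theory.
Local Open Scope ring_scope.

Record instance (R : realFieldType) (n : nat) := Instance {
  first_time : 'I_n -> R;
  delay : 'I_n -> R;
  second_time : 'I_n -> R
}.

Definition valid_instance (R : realFieldType) (n : nat) (X : instance R n) :=
  forall j : 'I_n,
    [/\ 0 < first_time X j, 0 <= delay X j & 0 < second_time X j].

(** Instances of 1 | (a_j, p_j, p_j) | sum C_j: first task, delay, second task. *)
Definition app_instance (R : realFieldType) (n : nat) (a p : 'I_n -> R) :=
  Instance a p p.

Section Schedules.
Variables (R : realFieldType) (n : nat) (X : instance R n).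

(** A schedule is given by the starting times of the jobs.  The 2n tasks are
    indexed by ['I_n * bool]: [(j, false)] is the first task of job j and
    [(j, true)] its second task. *)
Implicit Types (S : 'I_n -> R) (u v : 'I_n * bool).

Definition task_start S u : R :=
  if u.2 then S u.1 + first_time X u.1 + delay X u.1 else S u.1.

Definition task_length u : R :=
  if u.2 then second_time X u.1 else first_time X u.1.

Definition task_end S u : R := task_start S u + task_length u.

Definition feasible S : Prop :=
  (forall j, 0 <= S j) /\
  (forall u v, u != v -> forall x : R,
     ~ (task_start S u < x < task_end S u /\
        task_start S v < x < task_end S v)).

Definition completion S (j : 'I_n) : R :=
  S j + first_time X j + delay X j + second_time X j.

Definition sum_completion S : R := \sum_(j < n) completion S j.

End Schedules.

(** [algorithm3_schedule a p S]: S is a schedule that the algorithm may return,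
    ties in the sorting step being broken arbitrarily.  The job [s i] is the
    one in position i of the sorted order. *)
Definition algorithm3_schedule (R : realFieldType) (n : nat)
    (a p : 'I_n -> R) (S : 'I_n -> R) : Prop :=
  exists s : {perm 'I_n},
    [/\ forall i k : 'I_n, (i <= k)%N ->
          a (s i) + p (s i) <= a (s k) + p (s k),
        forall i : 'I_n, i = 0%N :> nat -> S (s i) = 0 &
        forall i k : 'I_n, k = i.+1 :> nat ->
          S (s k) = completion (app_instance a p) S (s i)].

(** Running time is measured on a random access machine.  Programs manipulate
    two kinds of data: natural numbers, used for addressing and control, and
    numbers of an ordered field R, on which they can only perform additions,
    subtractions and comparisons.  Memory consists of arrays named by natural
    numbers; a scalar variable is cell 0 of an array.  Programs contain no
    constant of R other than 0, so the same program runs over every R. *)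

Inductive iexp :=
| IConst of nat
| IGet of nat & iexp
| IAdd of iexp & iexp
| ISub of iexp & iexp.

Inductive dexp :=
| DZero
| DGet of nat & iexp
| DAdd of dexp & dexp
| DSub of dexp & dexp.

Inductive bexp :=
| ILt of iexp & iexp
| DLt of dexp & dexp.

Inductive cmd :=
| Skip
| ISet of nat & iexp & iexp
| DSet of nat & iexp & dexp
| Seq of cmd & cmd
| If of bexp & cmd & cmd
| While of bexp & cmd.

Definition update (T : Type) (m : nat -> nat -> T) (x i : nat) (v : T) :=
  fun y k => if (y == x) && (k == i) then v else m y k.

(** Number of binary digits of k (1 for k = 0). *)
Definition bits (k : nat) : nat := (trunc_log 2 k).+1.

Section Semantics.
Variable R : realFieldType.

(** The size charged for handling a number of R. *)
Variable dsize : R -> nat.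

Record state := State { imem : nat -> nat -> nat; dmem : nat -> nat -> R }.

Fixpoint ieval (st : state) (e : iexp) : nat :=
  match e with
  | IConst k => k
  | IGet x e1 => imem st x (ieval st e1)
  | IAdd e1 e2 => (ieval st e1 + ieval st e2)%N
  | ISub e1 e2 => (ieval st e1 - ieval st e2)%N
  end.

Fixpoint deval (st : state) (e : dexp) : R :=
  match e with
  | DZero => 0
  | DGet x e1 => dmem st x (ieval st e1)
  | DAdd e1 e2 => deval st e1 + deval st e2
  | DSub e1 e2 => deval st e1 - deval st e2
  end.

Definition beval (st : state) (b : bexp) : bool :=
  match b with
  | ILt e1 e2 => (ieval st e1 < ieval st e2)%N
  | DLt e1 e2 => deval st e1 < deval st e2
  end.

(** Logarithmic cost: every address, operand and result is charged its size. *)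
Fixpoint icost (st : state) (e : iexp) : nat :=
  (bits (ieval st e) +
   match e with
   | IConst _ => 0
   | IGet _ e1 => icost st e1
   | IAdd e1 e2 | ISub e1 e2 => icost st e1 + icost st e2
   end)%N.

Fixpoint dcost (st : state) (e : dexp) : nat :=
  (dsize (deval st e) +
   match e with
   | DZero => 0
   | DGet _ e1 => icost st e1
   | DAdd e1 e2 | DSub e1 e2 => dcost st e1 + dcost st e2
   end)%N.

Definition bcost (st : state) (b : bexp) : nat :=
  match b with
  | ILt e1 e2 => (icost st e1 + icost st e2)%N
  | DLt e1 e2 => (dcost st e1 + dcost st e2)%N
  end.

(** [exec c st t st']: started in st, c halts in st' after time t. *)
Inductive exec : cmd -> state -> nat -> state -> Prop :=
| ExecSkip st : exec Skip st 1 st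
| ExecISet st x e v :
    exec (ISet x e v) st (1 + icost st e + icost st v)
      (State (update (imem st) x (ieval st e) (ieval st v)) (dmem st))
| ExecDSet st x e v :
    exec (DSet x e v) st (1 + icost st e + dcost st v)
      (State (imem st) (update (dmem st) x (ieval st e) (deval st v)))
| ExecSeq c1 c2 st1 t1 st2 t2 st3 :
    exec c1 st1 t1 st2 -> exec c2 st2 t2 st3 ->
    exec (Seq c1 c2) st1 (t1 + t2) st3
| ExecIf b c1 c2 st t st' :
    exec (if beval st b then c1 else c2) st t st' ->
    exec (If b c1 c2) st (1 + bcost st b + t) st'
| ExecWhileEnd b c st :
    ~~ beval st b -> exec (While b c) st (1 + bcost st b) st
| ExecWhileStep b c st1 t1 st2 t2 st3 :
    beval st1 b -> exec c st1 t1 st2 -> exec (While b c) st2 t2 st3 ->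
    exec (While b c) st1 (1 + bcost st1 b + t1 + t2) st3.

End Semantics.

Definition vN := 0%N.
Definition vI := 1%N.
Definition vJ := 2%N.
Definition vM := 3%N.
Definition vT := 4%N.
Definition vOrder := 5%N.

Definition dA := 0%N.
Definition dP := 1%N.
Definition dS := 2%N.
Definition dTime := 3%N.

Definition ivar (x : nat) : iexp := IGet x (IConst 0).
Definition iassign (x : nat) (e : iexp) : cmd := ISet x (IConst 0) e.
Definition order_at (e : iexp) : iexp := IGet vOrder e.
Definition sort_key (j : iexp) : dexp := DAdd (DGet dA j) (DGet dP j).

Definition for_loop (x : nat) (lo : iexp) (body : cmd) : cmd :=
  Seq (iassign x lo)
    (While (ILt (ivar x) (ivar vN))
      (Seq body (iassign x (IAdd (ivar x) (IConst 1))))).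

(** Selection sort of the array of job indices by non-decreasing a_j + p_j. *)
Definition sort_jobs : cmd :=
  Seq (for_loop vI (IConst 0) (ISet vOrder (ivar vI) (ivar vI)))
  (for_loop vI (IConst 0)
    (Seq (iassign vM (ivar vI))
    (Seq (for_loop vJ (IAdd (ivar vI) (IConst 1))
           (If (DLt (sort_key (order_at (ivar vJ)))
                    (sort_key (order_at (ivar vM))))
               (iassign vM (ivar vJ))
               Skip))
    (Seq (iassign vT (order_at (ivar vI)))
    (Seq (ISet vOrder (ivar vI) (order_at (ivar vM)))
         (ISet vOrder (ivar vM) (ivar vT))))))).

(** [dTime] holds the completion time of the last scheduled job. *)
Definition schedule_jobs : cmd :=
  Seq (DSet dTime (IConst 0) DZero)
  (for_loop vI (IConst 0)
    (Seq (iassign vJ (order_at (ivar vI)))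
    (Seq (DSet dS (ivar vJ) (DGet dTime (IConst 0)))
         (DSet dTime (IConst 0)
           (DAdd (DAdd (DAdd (DGet dS (ivar vJ)) (DGet dA (ivar vJ)))
                       (DGet dP (ivar vJ)))
                 (DGet dP (ivar vJ))))))).

Definition algorithm3 : cmd := Seq sort_jobs schedule_jobs.

Definition tabulate (R : realFieldType) (n : nat) (f : 'I_n -> R) (k : nat) : R :=
  if insub k is Some j then f j else 0.

Definition input_state (R : realFieldType) (n : nat) (a p : 'I_n -> R) :
    state R :=
  State (fun x k => if (x == vN) && (k == 0%N) then n else 0%N)
        (fun x k => if x == dA then tabulate a k
                    else if x == dP then tabulate p k else 0).

Definition output_schedule (R : realFieldType) (n : nat) (st : state R) :
    'I_n -> R :=
  fun j => dmem st dS j.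

(** Binary encoding length of a rational number and of a rational instance. *)
Definition rat_size (x : rat) : nat :=
  (bits `|numq x|%N + bits `|denq x|%N)%N.

Definition input_size (n : nat) (a p : 'I_n -> rat) : nat :=
  (bits n + \sum_(j < n) (rat_size (a j) + rat_size (p j)))%N.

(** [halts_within dsize a p t]: on input (a, p) the program halts within time
    t, having computed a schedule of the algorithm. *)
Definition halts_within (R : realFieldType) (dsize : R -> nat) (n : nat)
    (a p : 'I_n -> R) (t : nat) : Prop :=
  exists (t' : nat) (st : state R),
    [/\ exec dsize algorithm3 (input_state a p) t' st,
        (t' <= t)%N &
        algorithm3_schedule a p (output_schedule st)].

(* Main.v *)
(** Put w = a + p.  In a feasible schedule the tasks of all jobs completed by
    time C_j are disjoint subintervals of [0, C_j], so C_j is at least the sum of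
    w_k over the jobs k with C_k <= C_j.  Summing over j, every unordered pair of
    distinct jobs contributes at least the smaller of its two weights; the
    sequence sorted by w attains this minimum, so the optimum is at least the sum
    of the prefix sums of w in sorted order.  The algorithm completes a job at the
    corresponding prefix sum of a + 2p, which is at most twice as large.

    For the running time, the program takes O((n+1)^2) steps, each costing O(M)
    where M bounds the indices and the sizes of all computed numbers.  Every such
    number is a sum of distinct input entries (each p_j used at most twice), so M
    is linear in the input size provided the size of a sum is at most the sum of
    the sizes.  On rationals this holds for the number of bits of
    |numerator| + denominator, as that quantity is submultiplicative:
    (|m| + d) (|m'| + d') >= |m d' + m' d| + d d'. *)
Require Import Defs.
From HB Require Import structures.
From mathcomp Require Import all_boot all_order all_algebra all_fingroup.
From mathcomp Require Import zify ring lra.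

Set Implicit Arguments.
Unset Strict Implicit.
Unset Printing Implicit Defensive.

Import Order.TTheory GRing.Theory Num.Theory.
Local Open Scope ring_scope.

(** * Approximation factor *)

Section Approximation.
Variable R : realFieldType.

Definition noncrossing (l r l' r' : R) : Prop :=
  forall x : R, ~ (l < x < r /\ l' < x < r').

Lemma noncrossing_le (l r l' r' : R) :
  l < r -> l' < r' -> r' <= r -> noncrossing l r l' r' -> r' <= l.
Proof.
move=> lr lr' rr disj; rewrite leNgt; apply/negP => lr'l.
(* If [l < r'], the midpoint of [max l l'] and [r'] lies in both open intervals. *)
apply: (disj ((Num.max l l' + r') / 2%:R)).
by case: (leP l l') => ll; split; apply/andP; split; lra.
Qed.

(** Remove the interval [i] with the largest right end: all others must end by [l i], so induction
    applies to them with [l i] in place of [C]. *)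
Lemma sum_lengths_le (I : finType) (l r : I -> R) (A : {set I}) (C : R) :
  0 <= C ->
  (forall i, i \in A -> [/\ 0 <= l i, l i < r i & r i <= C]) ->
  {in A &, forall i j, i != j -> noncrossing (l i) (r i) (l j) (r j)} ->
  \sum_(i in A) (r i - l i) <= C.
Proof.
elim: {A}_.+1 {-2}A (ltnSn #|A|) C => // m IH A Am C C0 bnd disj.
have [->|[i0 i0A]] := set_0Vmem A; first by rewrite big_set0.
have [i iA imax] := arg_maxP r i0A.
have {}iA : i \in A := iA.
have [li0 lir riC] := bnd _ iA.
rewrite (big_setD1 i) //=.
have: \sum_(j in A :\ i) (r j - l j) <= l i.
  apply: IH => //.
  - by rewrite (cardsD1 i) iA in Am; lia.
  - move=> j /setD1P[ji jA]; have [lj0 ljr _] := bnd _ jA; split=> //.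
    apply: (@noncrossing_le _ (r i) (l j)) => //; first exact: imax.
    by apply: disj => //; rewrite eq_sym.
  - by move=> j k /setD1P[_ jA] /setD1P[_ kA]; apply: disj.
by move=> ?; lra.
Qed.

Variables (n : nat) (a p : 'I_n -> R).
Hypothesis valid : valid_instance (app_instance a p).
Local Notation X := (app_instance a p).

Lemma completion_ge_work (S : 'I_n -> R) (j : 'I_n) :
  feasible X S ->
  \sum_(k | completion X S k <= completion X S j) (a k + p k)
    <= completion X S j.
Proof.
case=> S0 disj.
pose A := [set u : 'I_n * bool | completion X S u.1 <= completion X S j].
have pos k : 0 < a k /\ 0 < p k by have [] := valid k.
have : \sum_(u in A) (task_end X S u - task_start X S u) <= completion X S j.
  apply: sum_lengths_le => [|[k b]|u v _ _]; last exact: disj.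
    by have [? ?] := pos j; have := S0 j; rewrite /completion /=; lra.
  rewrite inE /=; have [? ?] := pos k; have := S0 k.
  rewrite /completion /task_end /task_start /task_length /= => ? ?.
  by case: b => /=; split; lra.
congr (_ <= _).
(* The sum over tasks is regrouped by job; the two tasks of [k] have lengths [a k] and [p k]. *)
rewrite (eq_bigl (fun u : 'I_n * bool =>
  (completion X S u.1 <= completion X S j) && true)); last first.
  by move=> u; rewrite inE andbT.
rewrite -(pair_big (fun k => completion X S k <= completion X S j) xpredT
  (fun k b => task_end X S (k, b) - task_start X S (k, b))) /=.
apply: eq_bigr => k _; rewrite big_bool /task_end /task_start /task_length /=.
by ring.
Qed.

(* Each unordered pair of distinct jobs costs at least the smaller of the two
   weights, and exactly that when the jobs are in sorted order. *)
Lemma sorted_prefix_sums_min (w : 'I_n -> R) (s : {perm 'I_n}) (C : 'I_n -> R) :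
  (forall i, 0 <= w i) ->
  (forall i k : 'I_n, (i <= k)%N -> w (s i) <= w (s k)) ->
  \sum_(i < n) \sum_(k < n | (k <= i)%N) w (s k)
    <= \sum_j \sum_(k | C k <= C j) w k.
Proof.
move=> w0 srt.
pose f i k : R := if C (s k) <= C (s i) then w (s k) else 0.
pose g (i k : 'I_n) : R := if (k <= i)%N then w (s k) else 0.
have -> : \sum_(i < n) \sum_(k < n | (k <= i)%N) w (s k) = \sum_i \sum_k g i k.
  by apply: eq_bigr => i _; rewrite big_mkcond.
have -> : \sum_j \sum_(k | C k <= C j) w k = \sum_i \sum_k f i k.
  rewrite (reindex_inj (@perm_inj _ s)); apply: eq_bigr => i _ /=.
  by rewrite (reindex_inj (@perm_inj _ s)) big_mkcond.
(* Doubling symmetrises the double sums, which can then be compared term by term over pairs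
   [(i, k)]. *)
have sym (F : 'I_n -> 'I_n -> R) :
    (\sum_i \sum_k F i k) *+ 2 = \sum_i \sum_k (F i k + F k i).
  rewrite mulr2n [X in _ + X = _]exchange_big -big_split.
  by apply: eq_bigr => i _; rewrite -big_split.
rewrite -(@ler_pMn2r _ 2) // !sym /=.
apply: ler_sum => i _; apply: ler_sum => k _; rewrite /f /g.
have [wi wk] := (w0 (s i), w0 (s k)).
(* Off the diagonal, [g] counts only the job placed earlier, which has the smaller weight, while at
   least one of the two comparisons of [C] holds in [f]. *)
case: (ltngtP i k) => [ik|ki|/val_inj->]; last by rewrite lexx.
- have := srt _ _ (ltnW ik).
  by case: (leP (C (s k))) => [_|/ltW ->]; [case: ifP => _; lra | lra].
- have := srt _ _ (ltnW ki).
  by case: (leP (C (s k))) => [_|/ltW ->]; [case: ifP => _; lra | lra].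
Qed.

(** * Feasibility and cost of the sequential schedule *)

Variables (S : 'I_n -> R) (s : {perm 'I_n}).
Hypothesis start0 : forall i : 'I_n, i = 0%N :> nat -> S (s i) = 0.
Hypothesis startS : forall i k : 'I_n, k = i.+1 :> nat ->
  S (s k) = completion X S (s i).

Lemma completion_prefix_sum (i : 'I_n) :
  completion X S (s i)
    = \sum_(k < n | (k <= i)%N) (a (s k) + p (s k) + p (s k)).
Proof.
have [m im] := ubnP (nat_of_ord i); elim: m i im => // m IH i im.
rewrite (bigD1 i) //=; set rest := \sum_(_ < n | _) _.
suff : S (s i) = rest by rewrite /completion /= => ->; ring.
case: (posnP i) => [i0|i_gt0].
  rewrite start0 // /rest big1 // => k /andP[]; rewrite i0 leqn0 => /eqP k0.
  by rewrite -(inj_eq val_inj) /= k0 i0.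
have lt_pred : (i.-1 < n)%N by have := ltn_ord i; lia.
rewrite (@startS (Ordinal lt_pred)) ?IH /=; [|by lia|by lia].
by apply: eq_bigl => k; rewrite -(inj_eq val_inj) /=; lia.
Qed.

Lemma completion_le_start (i k : 'I_n) :
  (i < k)%N -> completion X S (s i) <= S (s k).
Proof.
move=> ik; have lt_pred : (k.-1 < n)%N by have := ltn_ord k; lia.
rewrite (@startS (Ordinal lt_pred)) /=; last by lia.
rewrite !completion_prefix_sum /= [leRHS](bigID (fun l : 'I_n => (l <= i)%N)) /=.
rewrite [X in _ <= X + _](eq_bigl (fun l : 'I_n => (l <= i)%N)) ?lerDl; last by move=> l; lia.
by apply: sumr_ge0 => l _; have [/= ? ? ?] := valid (s l); lra.
Qed.

Lemma sequential_feasible : feasible X S.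
Proof.
have pos k : 0 < a k /\ 0 < p k by have [] := valid k.
have S0 k : 0 <= S k.
  rewrite -[k](permKV s); set i := (s^-1)%g k.
  case: (posnP i) => [i0|i_gt0]; first by rewrite start0.
  have n_gt0 : (0 < n)%N by have := ltn_ord i; lia.
  apply: le_trans (@completion_le_start (Ordinal n_gt0) i i_gt0).
  rewrite completion_prefix_sum; apply: sumr_ge0 => l _.
  by have := pos (s l); lra.
split=> // u v uv x [].
(* [s^-1] gives the position of a job. Tasks of one job are separated by its delay; for distinct
   jobs, the one placed earlier completes before the other starts. *)
wlog ord_uv : u v uv / ((s^-1)%g u.1 <= (s^-1)%g v.1)%N.
  move=> th xu xv; case: (leqP ((s^-1)%g u.1) ((s^-1)%g v.1)) => [|/ltnW] ord_uv.
    exact: (th u v).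
  by apply: (th v u) => //; rewrite eq_sym.
have [eq_uv|neq_uv] := eqVneq u.1 v.1.
  case: u v uv eq_uv {ord_uv} => [j b] [k c] /= uv jk; subst k.
  have [? ?] := pos j.
  by case: b c uv => [] []; rewrite ?eqxx // /task_end /task_start
    /task_length /= => _ /andP[? ?] /andP[? ?]; lra.
have ltuv : ((s^-1)%g u.1 < (s^-1)%g v.1)%N.
  by rewrite ltn_neqAle ord_uv andbT (inj_eq val_inj) (inj_eq perm_inj).
have := completion_le_start ltuv; rewrite !permKV.
case: u v {uv ord_uv neq_uv ltuv} => [j b] [k c] /=.
have [? ?] := pos j; have [? ?] := pos k.
by case: b c => [] []; rewrite /completion /task_end /task_start
    /task_length /= => ? /andP[? ?] /andP[? ?]; lra.
Qed.

Hypothesis sorted_s : forall i k : 'I_n, (i <= k)%N ->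
  a (s i) + p (s i) <= a (s k) + p (s k).

Lemma sequential_le_twice (S' : 'I_n -> R) :
  feasible X S' -> sum_completion X S <= 2%:R * sum_completion X S'.
Proof.
move=> feas.
have pos k : 0 < a k /\ 0 < p k by have [] := valid k.
have lb : \sum_(i < n) \sum_(k < n | (k <= i)%N) (a (s k) + p (s k))
    <= sum_completion X S'.
  apply: le_trans (ler_sum _ (fun j _ => completion_ge_work j feas)).
  apply: (@sorted_prefix_sums_min (fun j => a j + p j)) => // k.
  by have := pos k; lra.
apply: le_trans (ler_wpM2l _ lb) => //.
rewrite /sum_completion (reindex_inj (@perm_inj _ s)) /= mulr_sumr.
apply: ler_sum => i _; rewrite completion_prefix_sum mulr_sumr.
(* Termwise, [a + 2p <= 2(a + p)]. *)
by apply: ler_sum => k _; have := pos (s k); lra.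
Qed.

End Approximation.

(** * Total correctness with time bounds *)

Section TimedTriples.
Variables (R : realFieldType) (dsize : R -> nat) (M : nat).
Implicit Types (st : state R) (P : state R -> Prop).
Local Open Scope nat_scope.

Lemma bits_leS (k : nat) : bits k <= k.+1.
Proof.
rewrite /bits ltnS; case: k => // k.
exact: leq_trans (ltnW (ltn_expl _ _)) (trunc_logP _ _).
Qed.

Fixpoint isize (e : iexp) : nat :=
  (match e with
   | IConst _ => 0
   | IGet _ e1 => isize e1
   | IAdd e1 e2 | ISub e1 e2 => isize e1 + isize e2
   end).+1.

Fixpoint disize (e : dexp) : nat :=
  (match e with
   | DZero => 0
   | DGet _ e1 => isize e1
   | DAdd e1 e2 | DSub e1 e2 => disize e1 + disize e2
   end).+1.

(** Every intermediate value stays within [M], so that each node of the expression is charged at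
    most [M.+1]. *)
Fixpoint isafe st (e : iexp) : bool :=
  (ieval st e <= M) &&
  match e with
  | IConst _ => true
  | IGet _ e1 => isafe st e1
  | IAdd e1 e2 | ISub e1 e2 => isafe st e1 && isafe st e2
  end.

Fixpoint dsafe st (e : dexp) : bool :=
  (dsize (deval st e) <= M) &&
  match e with
  | DZero => true
  | DGet _ e1 => isafe st e1
  | DAdd e1 e2 | DSub e1 e2 => dsafe st e1 && dsafe st e2
  end.

Definition bsafe st (b : bexp) : bool :=
  match b with
  | ILt e1 e2 => isafe st e1 && isafe st e2
  | DLt e1 e2 => dsafe st e1 && dsafe st e2
  end.

Lemma icost_le st e : isafe st e -> icost st e <= isize e * M.+1.
Proof.
have bits_le v : v <= M -> bits v <= M.+1.
  by move=> vM; apply: leq_trans (bits_leS v) _.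
elim: e => [k|x e IH|e1 IH1 e2 IH2|e1 IH1 e2 IH2] /=.
- by move=> /andP[/bits_le]; lia.
- by move=> /andP[/bits_le ? /IH]; lia.
- by move=> /and3P[/bits_le ? /IH1 ? /IH2]; lia.
- by move=> /and3P[/bits_le ? /IH1 ? /IH2]; lia.
Qed.

Lemma dcost_le st e : dsafe st e -> dcost dsize st e <= disize e * M.+1.
Proof.
elim: e => [|x e|e1 IH1 e2 IH2|e1 IH1 e2 IH2] /=.
- by lia.
- by move=> /andP[? /icost_le]; lia.
- by move=> /and3P[? /IH1 ? /IH2]; lia.
- by move=> /and3P[? /IH1 ? /IH2]; lia.
Qed.

Definition bsize (b : bexp) : nat :=
  match b with
  | ILt e1 e2 => isize e1 + isize e2
  | DLt e1 e2 => disize e1 + disize e2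
  end.

Lemma bcost_le st b : bsafe st b -> bcost dsize st b <= bsize b * M.+1.
Proof.
by case: b => e1 e2 /=; [move=> /andP[/icost_le ? /icost_le] |
  move=> /andP[/dcost_le ? /dcost_le]]; lia.
Qed.

(* No assignment or test of the program has more than 19 expression nodes, so
   [20 * M.+1] pays for one step. *)
Definition runs (c : cmd) st (t : nat) P : Prop :=
  exists t' st', [/\ exec dsize c st t' st', t' <= t * (20 * M.+1) & P st'].

Definition iset st x k v : state R := State (update (imem st) x k v) (dmem st).
Definition dset st x k v : state R := State (imem st) (update (dmem st) x k v).

Lemma runs_skip st P : P st -> runs Skip st 1 P.
Proof. by exists 1, st; split=> //; constructor. Qed.

Lemma runs_iset st x e v P :
  isafe st e -> isafe st v -> isize e + isize v <= 19 ->
  P (iset st x (ieval st e) (ieval st v)) -> runs (ISet x e v) st 1 P.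
Proof.
move=> /icost_le ce /icost_le cv sz Pst.
by do 2 eexists; split; [constructor| |exact: Pst]; nia.
Qed.

Lemma runs_dset st x e v P :
  isafe st e -> dsafe st v -> isize e + disize v <= 19 ->
  P (dset st x (ieval st e) (deval st v)) -> runs (DSet x e v) st 1 P.
Proof.
move=> /icost_le ce /dcost_le cv sz Pst.
by do 2 eexists; split; [constructor| |exact: Pst]; nia.
Qed.

(** Taking the run of [c2] as postcondition of [c1] allows forward symbolic execution of a
    program. *)
Lemma runs_seq c1 c2 st t1 t2 P :
  runs c1 st t1 (fun st' => runs c2 st' t2 P) -> runs (Seq c1 c2) st (t1 + t2) P.
Proof.
case=> t1' [st1 [ex1 le1 [t2' [st2 [ex2 le2 Pst]]]]].
exists (t1' + t2'), st2; split=> //; last by rewrite mulnDl leq_add.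
exact: ExecSeq ex1 ex2.
Qed.

Lemma runs_if b c1 c2 st t P :
  bsafe st b -> bsize b <= 19 ->
  runs (if beval st b then c1 else c2) st t P -> runs (If b c1 c2) st t.+1 P.
Proof.
move=> /bcost_le cb sz [t' [st' [ex le Pst]]].
by do 2 eexists; split; [exact: ExecIf ex| |exact: Pst]; nia.
Qed.

Lemma runs_weaken c st t t' P : t <= t' -> runs c st t P -> runs c st t' P.
Proof.
move=> tt' [t1 [st1 [ex le Pst]]]; exists t1, st1; split=> //.
by apply: leq_trans le _; rewrite leq_mul2r tt' orbT.
Qed.

(** The invariant is required of the state after the counter update. Two units per round pay for
    test and increment, two more for the initial assignment and the final test. *)
Lemma runs_for (n l tb x : nat) (lo : iexp) (body : cmd)
    (Inv : nat -> state R -> Prop) st P :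
  n <= M -> x != vN -> isafe st lo -> isize lo <= 18 -> ieval st lo = l ->
  l <= n -> imem st vN 0 = n -> Inv l (iset st x 0 l) ->
  (forall i st', l <= i < n -> imem st' vN 0 = n -> imem st' x 0 = i ->
    Inv i st' ->
    runs body st' tb (fun st'' => [/\ imem st'' vN 0 = n, imem st'' x 0 = i &
      Inv i.+1 (iset st'' x 0 i.+1)])) ->
  (forall st', imem st' vN 0 = n -> Inv n st' -> P st') ->
  runs (for_loop x lo body) st (2 + n * (tb + 2)) P.
Proof.
move=> nM xN lo_safe lo_size lo_l ln stN Inv_l step done.
rewrite -[2]/(1 + 1) -addnA; apply: runs_seq; apply: runs_iset => //.
rewrite lo_l /=; set st1 := iset _ _ _ _.
have st1N : imem st1 vN 0 = n by rewrite /= /update eq_sym (negPf xN).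
have st1x : imem st1 x 0 = l by rewrite /= /update !eqxx.
have st1_Inv : Inv l st1 by [].
move: st1_Inv => {}Inv_l; clearbody st1.
(* The sharper count of [n - l] rounds is what the induction can carry, from an arbitrary state at
   the loop head. *)
apply: (@runs_weaken _ _ (1 + (n - l) * (tb + 2))); first by nia.
have [m] : exists m, m = n - l by eexists.
move=> mE; rewrite -mE {lo_l}.
elim: m l ln step st1 mE st1N st1x Inv_l => [|m IH] l ln step st1 mE st1N st1x Inv_l.
  have ln' : l = n by lia.
  have g_safe : bsafe st1 (ILt (ivar x) (ivar vN)) by rewrite /= st1x st1N; lia.
  do 2 eexists; split; first by apply: ExecWhileEnd; rewrite /= st1x st1N; lia.
    by have := bcost_le g_safe; rewrite /=; lia.
  by apply: done => //; rewrite -[in Inv _]ln'.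
have g_safe : bsafe st1 (ILt (ivar x) (ivar vN)) by rewrite /= st1x st1N; lia.
have l_lt : l <= l < n by lia.
have [t1 [st2 [ex1 le1 [st2N st2x Inv2]]]] := step l st1 l_lt st1N st1x Inv_l.
pose st3 := iset st2 x 0 l.+1.
have st3N : imem st3 vN 0 = n by rewrite /= /update eq_sym (negPf xN).
have st3x : imem st3 x 0 = l.+1 by rewrite /= /update !eqxx.
have lSn : l.+1 <= n by lia.
have step3 i st' : l.+1 <= i < n -> _ := fun li => step i st' ltac:(lia).
have mE' : m = n - l.+1 by lia.
have [t2 [st4 [ex2 le2 Pst]]] := IH l.+1 lSn step3 st3 mE' st3N st3x Inv2.
have inc_safe : isafe st2 (IAdd (ivar x) (IConst 1)) by rewrite /= st2x; lia.
have st2_safe : isafe st2 (IConst 0) by [].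
do 2 eexists; split; last exact: Pst.
  apply: (@ExecWhileStep _ _ _ _ _ _ st3) ex2.
    by rewrite /= st1x st1N; lia.
  apply: ExecSeq ex1 _.
  have -> : st3 = State (update (imem st2) x (ieval st2 (IConst 0))
     (ieval st2 (IAdd (ivar x) (IConst 1)))) (dmem st2).
    by rewrite /= st2x addn1.
  exact: ExecISet.
have c1 : bcost dsize st1 _ <= 4 * M.+1 := bcost_le g_safe.
have c2 : icost st2 _ <= 4 * M.+1 := icost_le inc_safe.
have c3 : icost st2 _ <= 1 * M.+1 := icost_le st2_safe.
nia.
Qed.

End TimedTriples.

(** * The program *)

Lemma sum_ltnS (V : nmodType) (n : nat) (F : 'I_n -> V) (i : 'I_n) :
  \sum_(k < n | (k < i.+1)%N) F k = \sum_(k < n | (k < i)%N) F k + F i.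
Proof.
rewrite (bigD1 i) //= addrC; congr (_ + _); apply: eq_bigl => k.
by rewrite -(inj_eq val_inj) /=; lia.
Qed.

Lemma tabulateE (R : realFieldType) (n : nat) (f : 'I_n -> R) (j : 'I_n) :
  tabulate f j = f j.
Proof. by rewrite /tabulate valK. Qed.

Section Program.
(** [h] is a subadditive size controlling [dsize]: the bit length of the height for rationals, the
    constant 1 for unit cost. *)
Variables (R : realFieldType) (dsize h : R -> nat).
Hypothesis dsize_le : forall x, (dsize x <= 2 * h x)%N.
Hypothesis h_subadd : forall x y, (h (x + y)%R <= h x + h y)%N.
Variables (n : nat) (a p : 'I_n -> R).

Definition work (j : 'I_n) : nat := (h (a j) + h (p j) + h (p j))%N.
(** The term [h 0] accounts for the empty sum, from which the clock starts. *)
Definition weight : nat := (h 0%R + \sum_(j < n) work j)%N.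
Definition bound : nat := (n + 2 * weight)%N.

Local Notation runs := (runs dsize bound).
Local Notation key j := (a j + p j).
Implicit Types (s : {perm 'I_n}) (st : state R).

(** Starting time of the job in position [i], and the content of [dTime] when the scheduling loop
    reaches [i]. *)
Definition busy s (i : nat) : R :=
  \sum_(k < n | (k < i)%N) (a (s k) + p (s k) + p (s k)).

Lemma work_le_weight (j : 'I_n) : (work j <= weight)%N.
Proof. by rewrite /weight (bigD1 j) //=; lia. Qed.

(** The jobs before position [i] and the job [s i] are distinct, so each is charged once; the spare
    [work (s i)] covers the additions that yield its completion time. *)
Lemma h_busy s (i : 'I_n) : (h (busy s i) + work (s i) <= weight)%N.
Proof.
have sum_le : (\sum_(k < n | (k < i.+1)%N) work (s k) <= \sum_(j < n) work j)%N.
  rewrite [leqRHS](reindex_inj (@perm_inj _ s)) /=.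
  by rewrite [leqRHS](bigID (fun k : 'I_n => (k < i.+1)%N)) /= leq_addr.
have sumS : (\sum_(k < n | (k < i.+1)%N) work (s k)
    = \sum_(k < n | (k < i)%N) work (s k) + work (s i))%N := sum_ltnS _ _.
suff : (h (busy s i) <= h 0%R + \sum_(k < n | (k < i)%N) work (s k))%N.
  by rewrite /weight; lia.
rewrite /busy; elim/big_rec2: _ => [|k u v _ IH]; first by rewrite addn0.
have := h_subadd (a (s k) + p (s k) + p (s k)) v.
have := h_subadd (a (s k) + p (s k)) (p (s k)).
by have := h_subadd (a (s k)) (p (s k)); rewrite /work; lia.
Qed.

Lemma dsize_leM x : (h x <= weight)%N -> (dsize x <= bound)%N.
Proof. by move=> hx; have := dsize_le x; rewrite /bound; lia. Qed.

Definition order_is st s : Prop := forall k : 'I_n, imem st vOrder k = s k.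

Definition holds_input st : Prop :=
  [/\ forall j : 'I_n, dmem st dA j = a j & forall j : 'I_n, dmem st dP j = p j].

Lemma key_safe st (j : 'I_n) e :
  holds_input st -> ieval st e = j -> isafe bound st e ->
  dsafe dsize bound st (sort_key e).
Proof.
case=> stA stP ej safe_e; rewrite /= ej safe_e stA stP !andbT.
have := work_le_weight j; have := h_subadd (a j) (p j); rewrite /work => ? ?.
by rewrite !dsize_leM //; lia.
Qed.

Lemma runs_init st :
  imem st vN 0 = n -> holds_input st ->
  runs (for_loop vI (IConst 0) (ISet vOrder (ivar vI) (ivar vI))) st
    (2 + n * (1 + 2)) (fun st' =>
    [/\ imem st' vN 0 = n, holds_input st' & order_is st' 1%g]).
Proof.
move=> stN stin.
apply: (@runs_for _ _ _ n 0 1 vI _ _ (fun i st' => holds_input st' /\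
   forall k, (k < i)%N -> imem st' vOrder k = k)) => //.
- by rewrite /bound; lia.
- move=> i st' /andP[_ ilt] st'N st'I [st'in ord].
  apply: runs_iset => //=; rewrite ?st'I /bound; try lia.
  split=> //=; split=> // k; rewrite ltnS leq_eqVlt /update /=.
  by case: eqP => //= _ /ord.
- by move=> st' st'N [st'in ord]; split=> // k; rewrite perm1 ord.
Qed.

Lemma runs_argmin st s (i : 'I_n) :
  imem st vN 0 = n -> holds_input st -> order_is st s ->
  imem st vI 0 = i -> imem st vM 0 = i ->
  runs (for_loop vJ (IAdd (ivar vI) (IConst 1))
           (If (DLt (sort_key (order_at (ivar vJ)))
                    (sort_key (order_at (ivar vM))))
               (iassign vM (ivar vJ))
               Skip)) st
    (2 + n * (2 + 2)) (fun st' =>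
    [/\ imem st' vN 0 = n, holds_input st', order_is st' s, imem st' vI 0 = i &
      exists m : 'I_n, [/\ imem st' vM 0 = m, (i <= m)%N &
        forall l : 'I_n, (i <= l)%N -> key (s m) <= key (s l)]]).
Proof.
move=> stN stin sts stI stM.
(* Invariant: [vM] points to a smallest key among positions [i] to [j - 1], initially the single
   position [i]. *)
apply: (@runs_for _ _ _ n i.+1 2 vJ _ _ (fun j st' => [/\ holds_input st',
  order_is st' s, imem st' vI 0 = i &
      exists m : 'I_n, [/\ imem st' vM 0 = m, (i <= m < j)%N &
        forall l : 'I_n, (i <= l < j)%N -> key (s m) <= key (s l)]])) => //.
- by rewrite /bound; lia.
- by rewrite /= stI /bound; have := ltn_ord i; lia.
- by rewrite /= stI addn1.
- split=> //; exists i; split=> //; first by rewrite leqnn /=.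
  move=> l; have [->|] := eqVneq l i; first by rewrite lexx.
  by rewrite -(inj_eq val_inj) /=; lia.
- move=> j st' /andP[ij jn] st'N st'J [st'in st's st'I [m [st'M im min_m]]].
  pose jo := Ordinal jn.
  have st'sj : imem st' vOrder j = s jo by rewrite -st's.
  have st'sm := st's m.
  have key_j : deval st' (sort_key (order_at (ivar vJ))) = key (s jo).
    by rewrite /= st'J st'sj; case: st'in => -> ->.
  have key_m : deval st' (sort_key (order_at (ivar vM))) = key (s m).
    by rewrite /= st'M st'sm; case: st'in => -> ->.
  apply: runs_if => //.
    apply/andP; split.
      apply: (@key_safe _ (s jo)) => //=; first by rewrite st'J.
      by rewrite st'J st'sj /bound; have := ltn_ord (s jo); lia.
    apply: (@key_safe _ (s m)) => //=; first by rewrite st'M.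
    rewrite st'M st'sm /bound; have := ltn_ord (s m); have := ltn_ord m; lia.
  rewrite (_ : beval _ _ = (key (s jo) < key (s m))); last by rewrite -key_j -key_m.
  case: (ltP (key (s jo)) (key (s m))) => [lt_jm|le_mj].
    apply: runs_iset => //=; first by rewrite st'J /bound; lia.
    rewrite st'J; split=> //; split=> //; exists jo; split=> //=; first by lia.
    move=> l il; have [->|] := eqVneq l jo; first by rewrite lexx.
    rewrite -(inj_eq val_inj) /= => lj; apply: le_trans (ltW lt_jm) _.
    by apply: min_m; lia.
  apply: runs_skip; split=> //; split=> //; exists m; split=> //; first by lia.
  move=> l il; have [->//|] := eqVneq l jo.
  by rewrite -(inj_eq val_inj) /= => lj; apply: min_m; lia.
- move=> st' st'N [? ? ? [m [? /andP[? ?] min_m]]]; split=> //; exists m.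
  by split=> // l il; apply: min_m; rewrite il /=.
Qed.

(** Since [l] is not bounded by [i], this also says that no later key is smaller than one of the
    first [i]. *)
Definition sorted_upto s (i : nat) : Prop := forall k l : 'I_n,
  (k < i)%N -> (k <= l)%N -> key (s k) <= key (s l).

(** The exchange only permutes positions from [i] on, so earlier keys remain below all of them, and
    position [i] receives the minimum of the rest. *)
Lemma sorted_upto_swap s (i m : 'I_n) :
  (i <= m)%N -> (forall l : 'I_n, (i <= l)%N -> key (s m) <= key (s l)) ->
  sorted_upto s i -> sorted_upto (tperm i m * s)%g i.+1.
Proof.
move=> im min_m srt k l; rewrite ltnS leq_eqVlt !permM => /orP[/eqP/val_inj->|ki] kl.
  rewrite tpermL; apply: min_m.
  by case: tpermP.
rewrite (@tpermD _ i m k); last 2 first.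
- by rewrite -(inj_eq val_inj) /=; lia.
- by rewrite -(inj_eq val_inj) /=; lia.
by apply: srt => //; case: tpermP => [_|_|//]; lia.
Qed.

Lemma runs_sort st :
  imem st vN 0 = n -> holds_input st ->
  runs sort_jobs st ((2 + n * (1 + 2)) + (2 + n * ((1 + ((2 + n * (2 + 2)) +
     (1 + (1 + 1)))) + 2))) (fun st' =>
    exists s, [/\ imem st' vN 0 = n, holds_input st', order_is st' s &
      sorted_upto s n]).
Proof.
move=> stN stin; apply: runs_seq.
have [t1 [st1 [ex1 le1 [st1N st1in st1s]]]] := runs_init stN stin.
exists t1, st1; split=> // {t1 ex1 le1}.
apply: (@runs_for _ _ _ n 0 _ vI _ _ (fun i st' => holds_input st' /\
   exists s, order_is st' s /\ sorted_upto s i)) => //.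
- by rewrite /bound; lia.
- by split=> //; exists 1%g.
- move=> i st2 /andP[_ ilt] st2N st2I [st2in [s [st2s srt]]].
  pose io := Ordinal ilt.
  apply: runs_seq; apply: runs_iset => //=; first by rewrite st2I /bound; lia.
  apply: runs_seq; set st3 := iset _ _ _ _.
  have [|||||t4 [st4 [ex4 le4 Pst4]]] := @runs_argmin st3 s io => //.
  exists t4, st4; split=> //.
  case: Pst4 => st4N st4in st4s st4I [m [st4M im min_m]].
  have st4si : imem st4 vOrder i = s io by rewrite -st4s.
  have mn := ltn_ord m; have smn := ltn_ord (s m); have sin := ltn_ord (s io).
  apply: runs_seq; apply: runs_iset => //=.
    by rewrite st4I /= st4si /bound; lia.
  apply: runs_seq; apply: runs_iset => //=.
  + by rewrite /update /= st4I /= /bound; lia.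
  + by rewrite /update /= st4M st4s /bound; lia.
  apply: runs_iset => //=.
  + by rewrite /update /= st4M /= /bound; lia.
  + by rewrite /update /= st4I /= st4si /bound; lia.
  rewrite /update /= st4I st4M /= st4si st4s; split=> //; split=> //.
  (* The product applies the transposition first, hence acts on positions. If [m = i], the second
     write hits the same cell, with the same value. *)
  exists (tperm io m * s)%g; split; last exact: sorted_upto_swap.
  move=> k /=; rewrite /update /= permM.
  case: tpermP => [->|->|/eqP km /eqP ki] /=.
  + by rewrite eqxx; case: ifP => // /eqP/(@val_inj _ _ _ io m) ->.
  + by rewrite eqxx.
  + by rewrite !(inj_eq val_inj) -[i]/(val io) (inj_eq val_inj) (negPf km) (negPf ki).
- by move=> st' st'N [? [s [? ?]]]; exists s.
Qed.

Lemma runs_schedule st s :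
  imem st vN 0 = n -> holds_input st -> order_is st s ->
  runs schedule_jobs st (1 + (2 + n * ((1 + (1 + 1)) + 2))) (fun st' =>
    forall k : 'I_n, dmem st' dS (s k) = busy s k).
Proof.
move=> stN stin sts; have h0 : (h 0%R <= weight)%N by rewrite /weight leq_addr.
apply: runs_seq; apply: runs_dset => //=; first by rewrite dsize_leM.
set st1 := dset _ _ _ _.
apply: (@runs_for _ _ _ n 0 _ vI _ _ (fun i st' => [/\ holds_input st',
  order_is st' s, dmem st' dTime 0 = busy s i &
   forall k : 'I_n, (k < i)%N -> dmem st' dS (s k) = busy s k])) => //.
- by rewrite /bound; lia.
- by split=> //=; rewrite /update /= /busy big_pred0.
- move=> i st2 /andP[_ ilt] st2N st2I [st2in st2s st2T st2S].
  pose io := Ordinal ilt; case: st2in => st2A st2P.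
  have st2si : imem st2 vOrder i = s io by rewrite -st2s.
  have sin := ltn_ord (s io).
  have hT := h_busy s io; rewrite /work /= in hT.
  have hTa := h_subadd (busy s i) (a (s io)).
  have hTap := h_subadd (busy s i + a (s io)) (p (s io)).
  have hTapp := h_subadd (busy s i + a (s io) + p (s io)) (p (s io)).
  apply: runs_seq; apply: runs_iset => //=.
    by rewrite st2I /= st2si /bound; lia.
  apply: runs_seq; apply: runs_dset => //=.
  + by rewrite /update /= st2I st2si /bound; lia.
  + by rewrite st2T dsize_leM //; lia.
  rewrite /update /= st2I st2si st2T.
  apply: runs_dset => //=.
    rewrite /update /= !eqxx st2A st2P !dsize_leM /bound; lia.
  rewrite /update /= !eqxx /= st2A st2P; split=> //; split=> //=.
    by rewrite /busy -[i]/(val io) sum_ltnS !addrA.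
  move=> k; rewrite ltnS leq_eqVlt => /orP[/eqP ki|ki].
    by rewrite (_ : k = io) ?eqxx //; apply: val_inj.
  (* Injectivity of [s] keeps the new write away from the starting times already stored. *)
  rewrite !(inj_eq val_inj) (inj_eq perm_inj) -(inj_eq val_inj) /=.
  by rewrite (ltn_eqF ki) st2S.
- by move=> st' _ [_ _ _ Sk] k; apply: Sk.
Qed.

(** Sorting takes [4 + 11n + 4n^2] units and scheduling [3 + 5n]. *)
Lemma algorithm3_halts_within (t : nat) :
  ((7 + 16 * n + 4 * n ^ 2) * (20 * bound.+1) <= t)%N ->
  halts_within dsize a p t.
Proof.
move=> tle.
have in0 : holds_input (input_state a p).
  by split=> j; rewrite /= tabulateE.
have [t1 [st1 [ex1 le1 [s [st1N st1in st1s srt]]]]] :=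
  @runs_sort (input_state a p) erefl in0.
have [t2 [st2 [ex2 le2 Sk]]] := runs_schedule st1N st1in st1s.
exists (t1 + t2)%N, st2; split; first exact: ExecSeq ex1 ex2.
  apply: leq_trans tle; apply: leq_trans (leq_add le1 le2) _.
  by rewrite -mulnDl leq_mul2r; apply/orP; right; nia.
exists s; split=> [i k ik|i i0|i k ki].
- by apply: srt.
- by rewrite /output_schedule Sk i0 /busy big_pred0.
- rewrite /output_schedule /completion /output_schedule !Sk ki /=.
  by rewrite /busy sum_ltnS !addrA.
Qed.

End Program.

(** * Sizes of rational numbers *)

Definition rat_height (x : rat) : nat := (`|numq x| + `|denq x|)%N.

(** Reduction to lowest terms divides both entries by a common nonzero factor. *)
Lemma rat_height_div (u v : int) : v != 0 ->
  (rat_height (u%:~R / v%:~R) <= `|u| + `|v|)%N.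
Proof.
move=> v0; rewrite /rat_height; case: divqP v0 => // k x k0 _.
by rewrite !abszM leq_add ?leq_pmull ?absz_gt0.
Qed.

Lemma rat_height_add (x y : rat) :
  (rat_height (x + y) <= rat_height x * rat_height y)%N.
Proof.
have -> : x + y = (numq x * denq y + numq y * denq x)%:~R
                    / (denq x * denq y)%:~R.
  rewrite -{1}[x]divq_num_den -{1}[y]divq_num_den addf_div ?intr_eq0 ?denq_neq0 //.
  by rewrite rmorphD !rmorphM.
apply: leq_trans (rat_height_div _ _) _; first by rewrite mulf_neq0 ?denq_neq0.
rewrite /rat_height; nia.
Qed.

Lemma bits_le_exp (k m : nat) : (0 < m)%N -> (k < 2 ^ m)%N -> (bits k <= m)%N.
Proof.
rewrite /bits; case: k => [|k] // m0 km; rewrite ltnNge.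
apply/negP => le; have := trunc_logP (isT : 1 < 2)%N (isT : 0 < k.+1)%N.
have := leq_pexp2l (isT : 0 < 2)%N le; lia.
Qed.

Lemma bitsM (k m : nat) : (bits (k * m) <= bits k + bits m)%N.
Proof.
apply: bits_le_exp => //; rewrite expnD.
by apply: ltn_mul; exact: trunc_log_ltn.
Qed.

Lemma leq_bits (k m : nat) : (k <= m)%N -> (bits k <= bits m)%N.
Proof. by move=> km; rewrite ltnS leq_trunc_log. Qed.

Lemma bits_rat_height (x : rat) : (bits (rat_height x) <= rat_size x)%N.
Proof.
apply: bits_le_exp => //; rewrite /rat_size expnD /rat_height.
have lt k : (k < 2 ^ bits k)%N by exact: trunc_log_ltn.
have := lt `|numq x|%N; have := lt `|denq x|%N.
(* Both powers are at least 2, and [u + v <= u * v] for such [u] and [v]. *)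
have : (2 ^ 1 <= 2 ^ bits `|numq x|)%N by rewrite leq_exp2l.
have : (2 ^ 1 <= 2 ^ bits `|denq x|)%N by rewrite leq_exp2l.
nia.
Qed.

Lemma rat_size_le (x : rat) : (rat_size x <= 2 * bits (rat_height x))%N.
Proof.
rewrite mul2n -addnn; apply: leq_add; apply: leq_bits.
  exact: leq_addr.
exact: leq_addl.
Qed.

Lemma bits_rat_height_add (x y : rat) :
  (bits (rat_height (x + y)) <= bits (rat_height x) + bits (rat_height y))%N.
Proof. exact: leq_trans (leq_bits (rat_height_add x y)) (bitsM _ _). Qed.

(** One polynomial serves both cost models, as [bound <= 7N + 3] in each; the second factor is
    [20 * (7N + 4)]. *)
Definition time_poly : {poly nat} :=
  (7%N%:P + 16%N%:P * 'X + 4%N%:P * 'X ^+ 2) * (20%N%:P * (7%N%:P * 'X + 4%N%:P)).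

Lemma horner_time_poly (N : nat) :
  (time_poly.[N] = (7 + 16 * N + 4 * N ^ 2) * (20 * (7 * N + 4)))%N.
Proof. by rewrite /time_poly !(hornerD, hornerM, hornerC, hornerX, hornerXn). Qed.

Theorem theorem10 :
  (* polynomial running time, in the bit model on rational instances *)
  (exists q : {poly nat},
     forall (n : nat) (a p : 'I_n -> rat),
       valid_instance (app_instance a p) ->
       halts_within rat_size a p q.[input_size a p]) /\
  (* polynomial running time on instances over an arbitrary ordered field,
     with unit-cost field operations *)
  (exists q : {poly nat},
     forall (R : realFieldType) (n : nat) (a p : 'I_n -> R),
       valid_instance (app_instance a p) ->
       halts_within (fun _ : R => 1%N) a p q.[n]) /\
  (* feasibility and approximation factor *)
  (forall (R : realFieldType) (n : nat) (a p S : 'I_n -> R),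
     valid_instance (app_instance a p) ->
     algorithm3_schedule a p S ->
     feasible (app_instance a p) S /\
     (forall S' : 'I_n -> R, feasible (app_instance a p) S' ->
        sum_completion (app_instance a p) S <=
          2%:R * sum_completion (app_instance a p) S')).
Proof.
have poly_le (n N B : nat) : (n <= N -> B <= 7 * N + 3 ->
    (7 + 16 * n + 4 * n ^ 2) * (20 * B.+1) <= time_poly.[N])%N.
  move=> nN BN; rewrite horner_time_poly.
  by apply: leq_mul; [rewrite -!mulnn; nia | lia].
split; [exists time_poly | split; [exists time_poly|]].
- move=> n a p _; pose h x := bits (rat_height x).
  apply: (@algorithm3_halts_within _ _ h).
  + exact: rat_size_le.
  + exact: bits_rat_height_add.
  have sizes : (\sum_(j < n) work h a p j
      <= 2 * \sum_(j < n) (rat_size (a j) + rat_size (p j)))%N.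
    rewrite big_distrr /=; apply: leq_sum => j _; rewrite /work /h.
    by have := bits_rat_height (a j); have := bits_rat_height (p j); lia.
  (* Every rational has positive size, so the input size dominates the number of jobs. *)
  have n_le : (n <= \sum_(j < n) (rat_size (a j) + rat_size (p j)))%N.
    rewrite -[leqLHS]card_ord -sum1_card; apply: leq_sum => j _.
    by rewrite /rat_size /bits; lia.
  apply: poly_le; rewrite /input_size /bound /weight; first by lia.
  have -> : h 0 = 1%N by [].
  lia.
- move=> R n a p _.
  apply: (@algorithm3_halts_within _ _ (fun=> 1%N)) => //.
  (* Here [weight] is [1 + 3n], so [bound] is [7n + 2]. *)
  apply: poly_le => //; rewrite /bound /weight /work sum_nat_const card_ord.
  lia.
- move=> R n a p S valid [s [srt start0 startS]]; split.
    exact: (sequential_feasible valid start0 startS).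
  by move=> S'; exact: (sequential_le_twice valid start0 startS srt).
Qed.
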